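(* Define integers $a_{\mathcal{G}}(n)$, $n\ge0$, by $a_{\mathcal{G}}(0)=1$, $a_{\mathcal{G}}(1)=-1$, $a_{\mathcal{G}}(2)=-1$ and, for $n\ge3$, $$a_{\mathcal{G}}(n)=-\frac12\left(\sum_{k=0}^{n-2}a_{\mathcal{G}}(k)\binom{n-1}{k}2^{n-1-k}+\sum_{k=0}^{n-1}a_{\mathcal{G}}(k)\binom{n}{k}2^{n-k}\right).$$ Then for all $n\ge1$, $$-2a_{\mathcal{G}}(2n)=\sum_{k=0}^{n-1}a_{\mathcal{G}}(2k)\,2^{2n-2k-1}\left[2\binom{2n}{2k}-\binom{2n-1}{2k}\right].$$ *)

(* Defs.v *)
From mathcomp Require Import all_boot all_order all_algebra.

Set Implicit Arguments.
Unset Strict Implicit.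
Unset Printing Implicit Defensive.

Import Order.TTheory GRing.Theory Num.Theory.

Local Open Scope ring_scope.

Definition aG_sum (a : nat -> int) (n : nat) : int :=
  \sum_(0 <= k < n.-1) a k * 'C(n.-1, k)%:Z * 2 ^+ (n.-1 - k) +
  \sum_(0 <= k < n) a k * 'C(n, k)%:Z * 2 ^+ (n - k).

(* The term of index [n], given a function [a] that is correct below [n].
   Every summand of [aG_sum a n] is even, so the division by 2 is exact:
   see [aG_rec]. *)
Definition aG_next (a : nat -> int) (n : nat) : int :=
  match n with
  | 0 => 1
  | 1 => -1
  | 2 => -1
  | _ => - (aG_sum a n %/ 2)%Z
  end.

Fixpoint aG_prefix (n : nat) : seq int :=
  if n is m.+1 then rcons (aG_prefix m) (aG_next (nth 0 (aG_prefix m)) m)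
  else [::].

Definition aG (n : nat) : int := nth 0 (aG_prefix n.+1) n.

Lemma size_aG_prefix n : size (aG_prefix n) = n.
Proof. by elim: n => //= n IHn; rewrite size_rcons IHn. Qed.

Lemma nth_aG_prefix n k : (k < n)%N -> nth 0 (aG_prefix n) k = aG k.
Proof.
elim: n => // n IHn; rewrite ltnS leq_eqVlt => /orP[/eqP -> //|lt_kn].
by rewrite /= nth_rcons size_aG_prefix lt_kn IHn.
Qed.

Lemma aGE n : aG n = aG_next (nth 0 (aG_prefix n)) n.
Proof. by rewrite /aG /= nth_rcons size_aG_prefix ltnn eqxx. Qed.

Lemma eq_aG_sum a b n :
  (forall k, (k < n)%N -> a k = b k) -> aG_sum a n = aG_sum b n.
Proof.
move=> eq_ab; congr (_ + _); apply: eq_big_nat => k /andP[_ lt_kn];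
  rewrite eq_ab //.
exact: leq_trans lt_kn (leq_pred n).
Qed.

Lemma dvdz_aG_sum a n : (2 %| aG_sum a n)%Z.
Proof.
have even_term m (x : int) k : (k < m)%N -> (2 %| x * 2 ^+ (m - k))%Z.
  move=> lt_km; apply: dvdz_mull.
  by rewrite -(@prednK (m - k)) ?subn_gt0 // exprS dvdz_mulr.
rewrite /aG_sum rpredD //; rewrite big_nat; apply: rpred_sum => k /andP[_ lt_k];
  exact: even_term.
Qed.

Lemma aG0 : aG 0 = 1. Proof. by []. Qed.
Lemma aG1 : aG 1 = -1. Proof. by []. Qed.
Lemma aG2 : aG 2 = -1. Proof. by []. Qed.

Lemma aG_rec n : (3 <= n)%N ->
  (aG n)%:~R = - (1 / 2) *
    (\sum_(0 <= k < n.-1)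
        (aG k)%:~R * 'C(n.-1, k)%:R * 2 ^+ (n.-1 - k) +
     \sum_(0 <= k < n) (aG k)%:~R * 'C(n, k)%:R * 2 ^+ (n - k)) :> rat.
Proof.
move=> le3n.
have aGn : aG n = - (aG_sum aG n %/ 2)%Z.
  rewrite aGE -(@eq_aG_sum (nth 0 (aG_prefix n))); last exact: nth_aG_prefix.
  by case: n le3n => [|[|[|n]]].
have eqS : (aG_sum aG n)%:~R = (aG_sum aG n %/ 2)%Z%:~R * 2 :> rat.
  by rewrite -[in LHS](divzK (dvdz_aG_sum aG n)) intrM.
transitivity (- (1 / 2) * (aG_sum aG n)%:~R : rat).
  by rewrite aGn eqS mulrNz mulNr mulrCA div1r mulVf ?mulr1.
congr (_ * _); rewrite /aG_sum intrD !rmorph_sum.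
by congr (_ + _); apply: eq_bigr => k _; rewrite /= !intrM rmorphXn.
Qed.

(* Main.v *)
Require Import Defs.
From mathcomp Require Import all_boot all_order all_algebra.
From mathcomp Require Import ring zify.

Import Order.TTheory GRing.Theory Num.Theory.

Local Open Scope ring_scope.

(** The recurrence says that the exponential generating function of [aG] is
    [exp (- x) / cosh x ^ 2 = sech x + sech' x]. Accordingly we solve
    [aG n = e n + e n.+1] with [e 0 = 1]. In terms of the binomial transform
    [T n e = \sum_k 'C(n, k) 2 ^ (n - k) e k] the recurrence becomes
    2-periodicity of [e n + T n e], so [e n + T n e = 2] for all [n], which is
    [(1 + exp (2 x)) * sech x = 2 exp x]. This characterises [e], and
    [(-1) ^ n * e n] satisfies it too, so [e] vanishes at odd indices and agrees
    with [aG] at even ones. The theorem is then the difference of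
    [e + T e = 2] at the indices [2 n] and [2 n - 1]. *)

(** On exponential generating functions this is multiplication by [exp (c x)]. The parameter [c]
    stays free because inverting the case [c = 2] uses [c = -2]. *)
Definition binom_trans (c : int) (n : nat) (u : nat -> int) : int :=
  \sum_(0 <= k < n.+1) u k * 'C(n, k)%:Z * c ^+ (n - k).

Lemma eq_binom_trans c n u v : u =1 v -> binom_trans c n u = binom_trans c n v.
Proof. by move=> eq_uv; apply: eq_bigr => k _; rewrite eq_uv. Qed.

Lemma binom_trans0 c u : binom_trans c 0 u = u 0%N.
Proof. by rewrite /binom_trans big_nat1 bin0 !mulr1. Qed.

Lemma binom_transD c n u v :
  binom_trans c n (fun k => u k + v k) = binom_trans c n u + binom_trans c n v.
Proof. by rewrite -big_split; apply: eq_bigr => k _; rewrite /= !mulrDl. Qed.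

Lemma binom_transZ c n a u :
  binom_trans c n (fun k => a * u k) = a * binom_trans c n u.
Proof. by rewrite [RHS]big_distrr; apply: eq_bigr => k _; rewrite /= !mulrA. Qed.

Lemma binom_trans_last c n u :
  binom_trans c n u =
  \sum_(0 <= k < n) u k * 'C(n, k)%:Z * c ^+ (n - k) + u n.
Proof. by rewrite /binom_trans big_nat_recr //= binn subnn !mulr1. Qed.

(** Pascal's rule; on generating functions, the product rule for the derivative of
    [exp (c x) * U x]. *)
Lemma binom_transS c n u :
  binom_trans c n.+1 u =
  c * binom_trans c n u + binom_trans c n (fun k => u k.+1).
Proof.
rewrite [LHS]binom_trans_last big_nat_recl // bin0 subn0.
rewrite [X in c * X]/binom_trans big_nat_recl // bin0 subn0.
rewrite (binom_trans_last _ _ (fun k => u k.+1)) exprS.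
under eq_bigr => k _ do rewrite binS PoszD mulrDr mulrDl subSS.
rewrite big_split /=.
have -> : \sum_(0 <= i < n) u i.+1 * 'C(n, i.+1)%:Z * c ^+ (n - i) =
          c * \sum_(0 <= i < n) u i.+1 * 'C(n, i.+1)%:Z * c ^+ (n - i.+1).
  rewrite big_distrr; apply: eq_big_nat => i /andP[_ lt_in].
  by rewrite /= -(subnSK lt_in) exprS; ring.
by ring.
Qed.

Lemma binom_transK c n u : binom_trans (- c) n (binom_trans c ^~ u) = u n.
Proof.
elim: n u => [|n IHn] u; first by rewrite !binom_trans0.
rewrite binom_transS IHn.
under eq_binom_trans => k do rewrite binom_transS.
by rewrite binom_transD binom_transZ !IHn; ring.
Qed.

Lemma binom_trans1 c n : binom_trans c n (fun=> 1) = (c + 1) ^+ n.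
Proof.
elim: n => [|n IHn]; first by rewrite binom_trans0.
by rewrite binom_transS IHn exprS; ring.
Qed.

(** The sign twist is the substitution of [- x] for [x], which turns [exp (c x)] into
    [exp (- c x)]. *)
Lemma binom_trans_sign c n u :
  binom_trans c n (fun k => (-1) ^+ k * u k) =
  (-1) ^+ n * binom_trans (- c) n u.
Proof.
elim: n u => [|n IHn] u; first by rewrite !binom_trans0 !mul1r.
rewrite !binom_transS IHn.
under [X in _ + X = _]eq_binom_trans => k do rewrite exprS -mulrA.
by rewrite binom_transZ IHn exprS; ring.
Qed.

(** The top term of the transform is [u n] itself, so once all earlier terms vanish the equation
    reads [2 * u n = 0]. *)
Lemma binom_trans2_ker u :
  (forall n, u n + binom_trans 2 n u = 0) -> forall n, u n = 0.
Proof.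
move=> u_ker n; elim/ltn_ind: n => n IHn.
have := u_ker n; rewrite binom_trans_last big_nat big1 => [|k /andP[_ lt_kn]].
  by lia.
by rewrite IHn // !mul0r.
Qed.

Lemma binom_trans2_odd_eq0 u :
  (forall n, u n + binom_trans 2 n u = 2) -> forall n, odd n -> u n = 0.
Proof.
move=> u_sol n odd_n.
(* Apply the inverse transform to the equation; the constant 2 becomes [2 * (-2 + 1) ^+ m]. *)
have transN m : binom_trans (- 2) m u = 2 * (-1) ^+ m - u m.
  have : binom_trans (- 2) m (fun k => u k + binom_trans 2 k u) =
         2 * binom_trans (- 2) m (fun=> 1).
    by rewrite -binom_transZ; apply: eq_binom_trans => k; rewrite u_sol.
  by rewrite binom_transD binom_transK binom_trans1 => <-; rewrite addrK.
(* The difference of the two solutions [u m] and [(-1) ^+ m * u m] lies in the kernel; at odd [n] it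
   equals [2 * u n]. *)
have /binom_trans2_ker/(_ n) : forall m,
    (u m + -1 * ((-1) ^+ m * u m)) +
    binom_trans 2 m (fun k => u k + -1 * ((-1) ^+ k * u k)) = 0.
  move=> m; rewrite binom_transD binom_transZ binom_trans_sign transN.
  have := u_sol m; rewrite -signr_odd.
  by case: (odd m); rewrite ?expr0 ?expr1; lia.
by rewrite -signr_odd odd_n expr1; lia.
Qed.

Lemma aG_sum_binom_trans a n :
  aG_sum a n.+1 =
  (binom_trans 2 n a - a n) + (binom_trans 2 n.+1 a - a n.+1).
Proof. by rewrite !binom_trans_last !addrK. Qed.

(* The initial values make the recurrence hold from index 1 on. *)
Lemma aG_binom_trans n :
  aG n.+1 + binom_trans 2 n.+1 aG + binom_trans 2 n aG = aG n.
Proof.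
have [lt_n2|le2n] := ltnP n 2.
  by case: n lt_n2 => [|[|//]] _; rewrite /binom_trans !big_nat_recr ?big_geq.
have aGn : aG n.+1 = - (aG_sum aG n.+1 %/ 2)%Z.
  rewrite aGE -(@eq_aG_sum (nth 0 (aG_prefix n.+1))); last exact: nth_aG_prefix.
  by case: n le2n => [|[|n]].
have := divzK (dvdz_aG_sum aG n.+1).
by rewrite -[X in X * 2]opprK -aGn aG_sum_binom_trans; lia.
Qed.

(** The sequence [e] of the overview, with generating function [sech x]: the recursion is
    [aG m = e m + e m.+1] solved for [e m.+1]. *)
Fixpoint secant (n : nat) : int :=
  if n is m.+1 then aG m - secant m else 1.

Lemma aG_secant n : aG n = secant n + secant n.+1.
Proof. by rewrite /=; ring. Qed.

Lemma binom_trans_aG n :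
  binom_trans 2 n aG = binom_trans 2 n.+1 secant - binom_trans 2 n secant.
Proof.
rewrite (eq_binom_trans _ _ _ _ aG_secant) binom_transD binom_transS.
by ring.
Qed.

Lemma secant_binom_trans n : secant n + binom_trans 2 n secant = 2.
Proof.
elim/ltn_ind: n => -[|[|n]] IHn.
- by rewrite binom_trans0.
- by rewrite binom_transS !binom_trans0.
(* In terms of [secant] the recurrence telescopes, so [secant n + binom_trans 2 n secant] takes the
   same value at [n] and [n.+2]. *)
have := aG_binom_trans n; have := IHn n (leqW (leqnn _)).
by rewrite !binom_trans_aG !aG_secant; lia.
Qed.

Lemma secant_odd n : odd n -> secant n = 0.
Proof. exact: binom_trans2_odd_eq0 secant_binom_trans n. Qed.

Lemma aG_even k : aG (2 * k) = secant (2 * k).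
Proof. by rewrite aG_secant (@secant_odd (2 * k).+1) ?addr0 //=; lia. Qed.

Lemma big_nat_double (F : nat -> int) n :
  (forall k, odd k -> F k = 0) ->
  \sum_(0 <= k < 2 * n) F k = \sum_(0 <= k < n) F (2 * k)%N.
Proof.
move=> F_odd; elim: n => [|n IHn]; first by rewrite !big_geq.
rewrite mulnS !add2n !big_nat_recr //= IHn (F_odd (2 * n).+1) ?addr0 //=.
by lia.
Qed.

Theorem mainTheorem19 (n : nat) (hn : (1 <= n)%N) :
  - 2 * aG (2 * n) =
  \sum_(0 <= k < n)
     aG (2 * k) * 2 ^+ (2 * n - 2 * k - 1) *
     (2 * ('C(2 * n, 2 * k))%:Z - ('C(2 * n - 1, 2 * k))%:Z).
Proof.
have trans_even : binom_trans 2 (2 * n) secant =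
    \sum_(0 <= k < n) secant (2 * k) * 'C(2 * n, 2 * k)%:Z *
      2 ^+ (2 * n - 2 * k) + secant (2 * n).
  rewrite binom_trans_last big_nat_double // => k odd_k.
  by rewrite secant_odd // !mul0r.
have trans_odd : binom_trans 2 (2 * n - 1) secant =
    \sum_(0 <= k < n) secant (2 * k) * 'C(2 * n - 1, 2 * k)%:Z *
      2 ^+ (2 * n - 1 - 2 * k).
  (* Since [1 <= n], the indices [k < (2 * n - 1).+1] are exactly those below [2 * n]. *)
  rewrite /binom_trans -subSn ?subn1 /=; last by lia.
  by rewrite big_nat_double // => k odd_k; rewrite secant_odd // !mul0r.
have := secant_binom_trans (2 * n).
have := secant_binom_trans (2 * n - 1).
rewrite (@secant_odd (2 * n - 1)); last by lia.
rewrite trans_even trans_odd add0r aG_even => sum_odd sum_even.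
under eq_bigr => k _ do rewrite aG_even mulrBr.
(* The two instances now read [2 * secant (2 * n) + S = 2] and [S' = 2]; the goal is
   [-2 * secant (2 * n) = S - S']. *)
rewrite sumrB; set S := \sum_(_ <= _ < _) _ in sum_even.
set S' := \sum_(_ <= _ < _) _ in sum_odd.
have -> : \sum_(0 <= k < n) secant (2 * k) * 2 ^+ (2 * n - 2 * k - 1) *
            (2 * 'C(2 * n, 2 * k)%:Z) = S.
  apply: eq_big_nat => k /andP[_ lt_kn].
  have -> : (2 * n - 2 * k = (2 * n - 2 * k - 1).+1)%N by lia.
  by rewrite subn1 exprS; ring.
have -> : \sum_(0 <= k < n) secant (2 * k) * 2 ^+ (2 * n - 2 * k - 1) *
            'C(2 * n - 1, 2 * k)%:Z = S'.
  by apply: eq_bigr => k _; rewrite subnAC; ring.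
by lia.
Qed.
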